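(* Consider $$x^{\Delta}(t)=a(t)x(t)+b(t)x(\delta_{-}(h,t))\delta_{-}^{\Delta}(h,t),\qquad t\in[t_0,\infty)_{\mathbb{T}}.\tag{E}$$ Put $Q(t):=a(t)+b(\delta_{+}(h,t))$ and $\beta(t):=t-\delta_{-}(h,t)$. Suppose there exists a positive constant $D$ such that $$\beta(t)<D\le\frac{Q(t)}{b(\delta_{+}(h,t))^{2}}$$ for all $t\in[t_0,\infty)_{\mathbb{T}}$. For a solution $x$ of (E) let $$A(t):=x(t)+\int_{\delta_{-}(h,t)}^{t}b(\delta_{+}(h,s))x(s)\,\Delta s .$$ If $$V(t)=A(t)^{2}-D\int_{\delta_{-}(h,t)}^{t}b(\delta_{+}(h,s))^{2}x(s)^{2}\,\Delta s,$$ then along the solutions of (E) $$V^{\Delta}(t)\ge Q(t)V(t)\quad\text{for all }t\in[t_0,\infty)_{\mathbb{T}}.$$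
   Context: A time scale $\mathbb{T}$ is a nonempty closed subset of $\mathbb{R}$; $\sigma(t)=\inf\{s\in\mathbb{T}:s>t\}$ is the forward jump operator, $\mu(t)=\sigma(t)-t$, $f^{\Delta}$ is the delta derivative, $\int\cdot\,\Delta s$ the delta integral, and $[a,b]_{\mathbb{T}}=[a,b]\cap\mathbb{T}$ (similarly for other intervals). ''rd-continuous'' means continuous at right-dense points with finite left-sided limits at left-dense points. Shift operators. Let $\mathbb{T}^{*}\subseteq\mathbb{T}$ be nonempty and $t_0\in\mathbb{T}^{*}$. Backward and forward shift operators $\delta_{-},\delta_{+}$ associated with the initial point $t_0$ are operators $\delta_{\pm}$ of $(s,t)\in[t_0,\infty)_{\mathbb{T}}\times\mathbb{T}^{*}$, with domains $\mathcal{D}_{\pm}=\{(s,t)\in[t_0,\infty)_{\mathbb{T}}\times\mathbb{T}^{*}:\delta_{\pm}(s,t)\in\mathbb{T}^{*}\}$ (pairs where the operator is defined with value in $\mathbb{T}^*$), satisfying: P.1: $\delta_{\pm}$ are strictly increasing in their second arguments, i.e. if $(T_0,t),(T_0,u)\in\mathcal{D}_{\pm}$, then $T_0\le t<u$ implies $\delta_{\pm}(T_0,t)<\delta_{\pm}(T_0,u)$. P.2: if $(T_1,u),(T_2,u)\in\mathcal{D}_{-}$ with $T_1<T_2$ then $\delta_{-}(T_1,u)>\delta_{-}(T_2,u)$; if $(T_1,u),(T_2,u)\in\mathcal{D}_{+}$ with $T_1<T_2$ then $\delta_{+}(T_1,u)<\delta_{+}(T_2,u)$. P.3: if $t\in[t_0,\infty)_{\mathbb{T}}$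 then $(t,t_0)\in\mathcal{D}_{+}$ and $\delta_{+}(t,t_0)=t$; if $t\in\mathbb{T}^{*}$ then $(t_0,t)\in\mathcal{D}_{+}$ and $\delta_{+}(t_0,t)=t$. P.4: if $(s,t)\in\mathcal{D}_{\pm}$ then $(s,\delta_{\pm}(s,t))\in\mathcal{D}_{\mp}$ and $\delta_{\mp}(s,\delta_{\pm}(s,t))=t$. P.5: if $(s,t)\in\mathcal{D}_{\pm}$ and $(u,\delta_{\pm}(s,t))\in\mathcal{D}_{\mp}$ then $(s,\delta_{\mp}(u,t))\in\mathcal{D}_{\pm}$ and $\delta_{\mp}(u,\delta_{\pm}(s,t))=\delta_{\pm}(s,\delta_{\mp}(u,t))$. Delay function. $\mathbb{T}$ is unbounded above, $h\in(t_0,\infty)_{\mathbb{T}}$ is a constant such that $(h,t)\in\mathcal{D}_{\pm}$ for all $t\in[t_0,\infty)_{\mathbb{T}}$, the function $t\mapsto\delta_{-}(h,t)$ is delta differentiable with rd-continuous derivative $\delta_{-}^{\Delta}(h,t)$, is strictly increasing, and maps $[t_0,\infty)_{\mathbb{T}}$ onto $[\delta_{-}(h,t_0),\infty)_{\mathbb{T}}$; its inverse is $\delta_{+}(h,\cdot)$. Standing assumptions: $t_0\ge 0$; $a,b:\mathbb{T}\to\mathbb{R}$ are rd-continuous; $|\delta_{-}^{\Delta}(h,t)|\le M<\infty$ for all $t\in[t_0,\infty)_{\mathbb{T}}$. A solution of (E) is $x=x(t,t_0,\psi)$ satisfying (E) on $[t_0,\infty)_{\mathbb{T}}$ with $x=\psi$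 on $[\delta_{-}(h,t_0),t_0]_{\mathbb{T}}$, where $\psi:[\delta_{-}(h,t_0),t_0]_{\mathbb{T}}\to\mathbb{R}$ is a given rd-continuous initial function. The hypothesis on $D$ is understood to include $b(\delta_{+}(h,t))\neq0$, so that the quotient makes sense. *)

(* Defs.v *)
From mathcomp Require Import all_boot all_order all_algebra.
From mathcomp Require Import all_classical all_reals all_analysis.
Set Implicit Arguments.
Unset Strict Implicit.
Unset Printing Implicit Defensive.
Import Order.TTheory GRing.Theory Num.Theory.
Import numFieldNormedType.Exports.
Local Open Scope classical_set_scope.
Local Open Scope ring_scope.

(* MathComp-Analysis world.  A function on a subset of R is a total function
   R -> R; its values outside the subset are never used. *)

Section TimeScale.
Context {R : realType}.
Implicit Types (T A : set R) (f F : R -> R).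

Definition time_scale T : Prop := T !=set0 /\ closed T.

Definition unbounded_above T : Prop := ~ has_ubound T.

(* [c, +oo[ and [c, d] intersected with T.  When T is a time scale, unbounded
   above, and c is in T, the ray is again such a time scale. *)
Definition ts_ray T (c : R) : set R := T `&` [set t | c <= t].
Definition ts_itv T (c d : R) : set R := T `&` [set t | c <= t <= d].

(* The conventions for the supremum of T are not needed: every time scale
   below is unbounded above, so the infimum is over a nonempty set. *)
Definition fjump T (t : R) : R := inf [set s | T s /\ t < s].
Definition bjump T (t : R) : R := sup [set s | T s /\ s < t].

Definition right_dense T (t : R) : Prop := T t /\ fjump T t = t.
Definition left_dense T (t : R) : Prop :=
  [/\ T t, [set s | T s /\ s < t] !=set0 & bjump T t = t].

(* Rd-continuity of f : A -> R, for A included in T; points of A are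
   classified in T, limits are taken along A. *)
Definition rd_continuous T A f : Prop := forall t, A t ->
  (right_dense T t -> f @ within A (nbhs t) --> f t) /\
  (left_dense T t ->
     exists l : R, f @ within (A `&` [set s | s < t]) (nbhs t) --> l).

Definition is_delta_derive T f (t l : R) : Prop :=
  forall e : R, 0 < e ->
    \forall s \near t, T s ->
      `|f (fjump T t) - f s - l * (fjump T t - s)| <= e * `|fjump T t - s|.

Definition delta_derivable T f (t : R) : Prop :=
  exists l : R, is_delta_derive T f t l.

(* The value is 0 when f is not delta differentiable at t. *)
Definition delta_derive T f (t : R) : R := xget 0 (is_delta_derive T f t).

Definition delta_antiderivative T f F : Prop :=
  forall t, T t -> is_delta_derive T F t (f t).

(* Cauchy delta integral of f : T -> R from c to d, for T unbounded above: the
   increment of an antiderivative.  The value is 0 when f has none; an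
   rd-continuous f always has one. *)
Definition delta_integral T f (c d : R) : R :=
  xget 0 [set v | exists2 F, delta_antiderivative T f F & v = F d - F c].

End TimeScale.

Section Shift.
Context {R : realType}.
Implicit Types (T Tstar : set R).

(* Shift operators are partial: None means undefined. *)
Definition shift_op := R -> R -> option R.

Definition shift_val (delta : shift_op) (s t : R) : R := odflt 0 (delta s t).

Definition shift_dom T Tstar t0 (delta : shift_op) (s t : R) : Prop :=
  [/\ ts_ray T t0 s, Tstar t & exists2 v, delta s t = Some v & Tstar v].

Definition shift_increasing_snd T Tstar t0 (delta : shift_op) : Prop :=
  forall r0 t u, shift_dom T Tstar t0 delta r0 t ->
    shift_dom T Tstar t0 delta r0 u ->
    r0 <= t -> t < u -> shift_val delta r0 t < shift_val delta r0 u.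

Definition shift_cancel T Tstar t0 (delta delta' : shift_op) : Prop :=
  forall s t, shift_dom T Tstar t0 delta s t ->
    shift_dom T Tstar t0 delta' s (shift_val delta s t) /\
    shift_val delta' s (shift_val delta s t) = t.

(* The first conjunct of the conclusion says that delta' u t, which occurs in
   the other two, is defined. *)
Definition shift_commute T Tstar t0 (delta delta' : shift_op) : Prop :=
  forall s t u, shift_dom T Tstar t0 delta s t ->
    shift_dom T Tstar t0 delta' u (shift_val delta s t) ->
    [/\ shift_dom T Tstar t0 delta' u t,
        shift_dom T Tstar t0 delta s (shift_val delta' u t) &
        shift_val delta' u (shift_val delta s t) =
          shift_val delta s (shift_val delta' u t)].

Record shift_operators T Tstar t0 (dm dp : shift_op) : Prop := {
  shift_sub : Tstar `<=` T;
  shift_init : Tstar t0;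
  shift_P1m : shift_increasing_snd T Tstar t0 dm;
  shift_P1p : shift_increasing_snd T Tstar t0 dp;
  shift_P2m : forall r1 r2 u, shift_dom T Tstar t0 dm r1 u ->
    shift_dom T Tstar t0 dm r2 u -> r1 < r2 ->
    shift_val dm r1 u > shift_val dm r2 u;
  shift_P2p : forall r1 r2 u, shift_dom T Tstar t0 dp r1 u ->
    shift_dom T Tstar t0 dp r2 u -> r1 < r2 ->
    shift_val dp r1 u < shift_val dp r2 u;
  shift_P3_ray : forall t, ts_ray T t0 t ->
    shift_dom T Tstar t0 dp t t0 /\ shift_val dp t t0 = t;
  shift_P3_star : forall t, Tstar t ->
    shift_dom T Tstar t0 dp t0 t /\ shift_val dp t0 t = t;
  shift_P4m : shift_cancel T Tstar t0 dm dp;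
  shift_P4p : shift_cancel T Tstar t0 dp dm;
  shift_P5m : shift_commute T Tstar t0 dm dp;
  shift_P5p : shift_commute T Tstar t0 dp dm }.

(* t |-> delta_-(h, t) lives on the ray from t0, and is differentiated with
   respect to that time scale. *)
Record delay_shift T Tstar t0 (dm dp : shift_op) (h : R) : Prop := {
  delay_h : T h /\ t0 < h;
  delay_domm : forall t, ts_ray T t0 t -> shift_dom T Tstar t0 dm h t;
  delay_domp : forall t, ts_ray T t0 t -> shift_dom T Tstar t0 dp h t;
  delay_derivable : forall t, ts_ray T t0 t ->
    delta_derivable (ts_ray T t0) (shift_val dm h) t;
  delay_rd : rd_continuous T (ts_ray T t0)
    (delta_derive (ts_ray T t0) (shift_val dm h));
  delay_increasing : forall t u, ts_ray T t0 t -> ts_ray T t0 u ->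
    t < u -> shift_val dm h t < shift_val dm h u;
  delay_onto : shift_val dm h @` ts_ray T t0 = ts_ray T (shift_val dm h t0);
  delay_invl : forall t, ts_ray T t0 t ->
    shift_val dp h (shift_val dm h t) = t;
  delay_invr : forall t, ts_ray T (shift_val dm h t0) t ->
    shift_val dm h (shift_val dp h t) = t }.

(* x solves x^Delta(t) = a(t) x(t) + b(t) x(delta_-(h,t)) delta_-^Delta(h,t) on
   the ray from t0, with initial function psi.  The derivative of x is taken in
   the time scale given by the ray, hence is one-sided at t0. *)
Definition is_solution T t0 (dm : shift_op) (h : R) (a b psi x : R -> R) :
    Prop :=
  (forall t, ts_ray T t0 t ->
     delta_derivable (ts_ray T t0) x t /\
     delta_derive (ts_ray T t0) x t =
       a t * x t + b t * x (shift_val dm h t)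
                   * delta_derive (ts_ray T t0) (shift_val dm h) t) /\
  (forall t, ts_itv T (shift_val dm h t0) t0 t -> x t = psi t).

End Shift.

(* Main.v *)
Require Import Defs.
From mathcomp Require Import all_boot all_order all_algebra.
From mathcomp Require Import all_classical all_reals all_analysis.
From mathcomp Require Import ring lra.
Import Order.TTheory GRing.Theory Num.Theory.
Import numFieldNormedType.Exports.
Local Open Scope classical_set_scope.
Local Open Scope ring_scope.

(* Because b (delta_+ (h, delta_- (h, t))) = b t, differentiating the integral
   cancels the delay term and A^Delta = Q x.  Hence
     V^Delta = Q x (2 A + mu Q x) - D (b_+^2 x^2 - b^2 x(delta_-)^2 delta_-^Delta)
   with b_+ = b o delta_+ and delta_-^Delta >= 0.  Write I and W for the
   integrals of b_+ x and (b_+ x)^2 over the delay interval.  Then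
   2 x A = A^2 + x^2 - I^2, where Q x^2 >= D b_+^2 x^2 by hypothesis and
   I^2 <= beta W <= D W by Cauchy-Schwarz, so V^Delta >= Q (A^2 - D W).

   The integrals are meaningful because an rd-continuous function f has an
   antiderivative: the largest function whose increment over each [p, q[ is at
   most K (q - p) whenever f <= K there. *)

(** * Forward jumps in closed sets that are unbounded above *)

Section Jump.
Context {R : realType}.
Implicit Types (T : set R) (c t s e : R).

Lemma closed_inf T (E : set R) : closed T -> E `<=` T -> has_inf E -> T (inf E).
Proof.
move=> cT ET hE; apply: cT => B /nbhs_ballP[e /= e0 eB].
have [z Ez zlt] := inf_adherent e0 hE.
exists z; split; first exact: ET.
apply: eB; rewrite /ball /= distrC ger0_norm; first by lra.
by rewrite subr_ge0; apply: ge_inf => //; exact: hE.2.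
Qed.

Lemma closed_sup T (E : set R) : closed T -> E `<=` T -> has_sup E -> T (sup E).
Proof.
move=> cT ET hE; apply: cT => B /nbhs_ballP[e /= e0 eB].
have [z Ez zlt] := sup_adherent e0 hE.
exists z; split; first exact: ET.
apply: eB; rewrite /ball /= ger0_norm; first by lra.
by rewrite subr_ge0; apply: ub_le_sup => //; exact: hE.2.
Qed.

Lemma unbounded_gt T t : unbounded_above T -> exists2 s, T s & t < s.
Proof.
move=> Tub; apply: contrapT => nex; apply: Tub; exists t => s Ts.
by rewrite leNgt; apply/negP => ts; apply: nex; exists s.
Qed.

Lemma closed_ray T c : closed T -> closed (ts_ray T c).
Proof. by move=> cT; apply: closedI => //; exact: closed_ge. Qed.

Lemma unbounded_ray T c : unbounded_above T -> unbounded_above (ts_ray T c).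
Proof.
move=> Tub [M hM]; have [s Ts] := unbounded_gt T (Num.max M c) Tub.
rewrite gt_max => /andP[Ms cs]; have := hM s; rewrite leNgt Ms.
by move=> h; suff: false by []; apply: h; split => //=; exact: ltW.
Qed.

(** The points of [T] beyond [t] already lie in the ray. This lets derivatives taken on different
    rays be compared. *)
Lemma fjump_ray T c t : c <= t -> fjump (ts_ray T c) t = fjump T t.
Proof.
move=> ct; congr inf; apply/seteqP; split=> s /= [].
  by move=> [Ts _] ts.
by move=> Ts ts; split=> //; split=> //=; lra.
Qed.

Section Closed.
Variable T : set R.
Hypotheses (cT : closed T) (Tub : unbounded_above T).

Lemma has_inf_fjump t : has_inf [set s | T s /\ t < s].
Proof.
split; last by exists t => s /= [_ /ltW].
by have [s Ts ts] := unbounded_gt T t Tub; exists s.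
Qed.

Lemma fjump_mem t : T (fjump T t).
Proof. by apply: closed_inf => // [s []//|]; exact: has_inf_fjump. Qed.

Lemma fjump_ge t : t <= fjump T t.
Proof.
by apply: lb_le_inf; [have [] := has_inf_fjump t | move=> s /= [_ /ltW]].
Qed.

Lemma fjump_le t s : T s -> t < s -> fjump T t <= s.
Proof. by move=> Ts ts; apply: ge_inf; [have [] := has_inf_fjump t|]. Qed.

Lemma lt_fjump t s : T s -> s < fjump T t -> s <= t.
Proof.
by move=> Ts st; rewrite leNgt; apply/negP => /(fjump_le _ _ Ts); rewrite leNgt st.
Qed.

Lemma fjump_eq_near t e : fjump T t = t -> 0 < e ->
  exists s, [/\ T s, t < s & s < t + e].
Proof.
move=> st e0; have [s /= [Ts ts]] := inf_adherent e0 (has_inf_fjump t).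
by rewrite -/(fjump T t) st => se; exists s.
Qed.

End Closed.

End Jump.

(** * Rules for the delta derivative *)

Section DeltaDerive.
Context {R : realType}.
Implicit Types (T : set R) (f g F G nu : R -> R) (c t s l m e : R).

(** Supplies the tolerance in the epsilon arguments: [K] collects the constants in front of [d], and
    [d <= 1] bounds the nearby values that enter them. *)
Lemma small_factor K e : 0 <= K -> 0 < e ->
  exists d : R, [/\ 0 < d, d <= 1 & d * K <= e].
Proof.
move=> K0 e0; exists (Num.min 1 (e / (K + 1))).
have K1 : 0 < K + 1 by lra.
rewrite lt_min ltr01 divr_gt0// ge_min lexx; split=> //.
have : Num.min 1 (e / (K + 1)) <= e / (K + 1) by rewrite ge_min lexx orbT.
rewrite ler_pdivlMr// => h; apply: le_trans h.
by rewrite ler_wpM2l// ?le_min ?ler01 ?divr_ge0//; lra.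
Qed.

Lemma near_dist t e : 0 < e -> \forall s \near t, `|t - s| < e.
Proof. by move=> e0; exact: (near_ball t e). Qed.

(** The neighbourhoods in the definition contain [t] itself, so [s = t] may be taken for every
    tolerance. *)
Lemma delta_derive_jump T f t l : T t -> is_delta_derive T f t l ->
  f (fjump T t) - f t = l * (fjump T t - t).
Proof.
move=> Tt df; apply/eqP; rewrite -subr_eq0 -normr_le0.
apply/ler_addgt0Pl => e e0; rewrite addr0.
have [d [d0 _ de]] := small_factor _ _ (normr_ge0 (fjump T t - t)) e0.
by apply: le_trans de; have /nbhs_singleton := df _ d0; apply.
Qed.

Lemma is_delta_derive_cst T c t : is_delta_derive T (fun=> c) t 0.
Proof.
move=> e e0; near=> s => _.
by rewrite mul0r !subrr normr0 mulr_ge0// ltW.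
Unshelve. all: by end_near.
Qed.

Lemma is_delta_derive_id T t : is_delta_derive T id t 1.
Proof.
move=> e e0; near=> s => _; by rewrite mul1r subrr normr0 mulr_ge0// ltW.
Unshelve. all: by end_near.
Qed.

Lemma is_delta_derive_lin T f g t k l m :
  is_delta_derive T f t l -> is_delta_derive T g t m ->
  is_delta_derive T (fun u => f u + k * g u) t (l + k * m).
Proof.
move=> df dg e e0.
have [d [d0 _ de]] := small_factor _ _ (addr_ge0 ler01 (normr_ge0 k)) e0.
have := dg _ d0; have := df _ d0; apply: filterS2 => s fs gs Ts.
set u := fjump T t in fs gs *.
have -> : f u + k * g u - (f s + k * g s) - (l + k * m) * (u - s) =
  (f u - f s - l * (u - s)) + k * (g u - g s - m * (u - s)) by ring.
apply: le_trans (ler_normD _ _) _; rewrite normrM.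
apply: le_trans (lerD (fs Ts) (ler_wpM2l (normr_ge0 k) (gs Ts))) _.
have := ler_wpM2r (normr_ge0 (u - s)) de; lra.
Qed.

(** The smaller set only removes test points [s]. It serves to pass from the ray at [nu t0] to the
    ray at [t0]. *)
Lemma is_delta_derive_subset T T' f t l : T' `<=` T -> fjump T' t = fjump T t ->
  is_delta_derive T f t l -> is_delta_derive T' f t l.
Proof.
move=> sub eqj df e e0; have := df _ e0; apply: filterS => s fs T's.
by rewrite eqj; apply: fs; exact: sub.
Qed.

Lemma delta_derive_near T f t l : T t -> is_delta_derive T f t l ->
  forall e, 0 < e -> \forall s \near t, T s -> `|f t - f s| < e.
Proof.
move=> Tt df e e0; set u := fjump T t.
(* [|u - t| + 1] bounds [|u - s|], [|l|] comes from the linear term, and the last [1] makes the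
   final inequality strict. *)
have K0 : 0 <= `|u - t| + 1 + `|l| + 1.
  by have := normr_ge0 (u - t); have := normr_ge0 l; lra.
have [d [d0 d1 de]] := small_factor _ _ K0 e0.
have := near_dist t _ d0; have := df _ d0; apply: filterS2 => s fs ts Ts.
have {}fs := fs Ts; rewrite -/u in fs.
have fut := delta_derive_jump _ _ _ _ Tt df; rewrite -/u in fut.
have -> : f t - f s = (f u - f s - l * (u - s)) + l * (t - s).
  by lra.
apply: le_lt_trans (ler_normD _ _) _; rewrite normrM.
have ust : `|u - s| <= `|u - t| + 1.
  have -> : u - s = (u - t) + (t - s) by ring.
  by apply: le_trans (ler_normD _ _) _; rewrite lerD2l; lra.
have h1 : d * `|u - s| <= d * (`|u - t| + 1) by rewrite ler_wpM2l// ltW.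
have h2 : `|l| * `|t - s| <= `|l| * d by rewrite ler_wpM2l// ltW.
have h3 : 0 < d * 1 by lra.
lra.
Qed.

Lemma is_delta_derive_sqr T f t l : T t -> is_delta_derive T f t l ->
  is_delta_derive T (fun u => f u ^+ 2) t (l * (f t + f (fjump T t))).
Proof.
move=> Tt df e e0; set u := fjump T t.
have K0 : 0 <= `|f u| + `|f t| + 1 + `|l|.
  by have := normr_ge0 (f u); have := normr_ge0 (f t); have := normr_ge0 l; lra.
have [d [d0 d1 de]] := small_factor _ _ K0 e0.
have := delta_derive_near _ _ _ _ Tt df _ d0; have := df _ d0; apply: filterS2 => s fs ts Ts.
have {}fs := fs Ts; rewrite -/u in fs; have {}ts := ts Ts.
have -> : f u ^+ 2 - f s ^+ 2 - l * (f t + f u) * (u - s) =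
  (f u - f s - l * (u - s)) * (f u + f s) - l * (u - s) * (f t - f s) by ring.
apply: le_trans (ler_normB _ _) _; rewrite !normrM.
have fus : `|f u + f s| <= `|f u| + `|f t| + 1.
  have -> : f u + f s = f u + f t - (f t - f s) by ring.
  apply: le_trans (ler_normB _ _) _; have := ler_normD (f u) (f t); lra.
have h1 := ler_pM (normr_ge0 _) (normr_ge0 _) fs fus.
have h2 := ler_wpM2l (mulr_ge0 (normr_ge0 l) (normr_ge0 (u - s))) (ltW ts).
have h3 := ler_wpM2r (normr_ge0 (u - s)) de.
lra.
Qed.

(** The simple product [m * l] is correct because [nu] commutes with the jumps: the increment of [G]
    from [nu s] to [nu (fjump T t)] is then the one controlled by the derivative of [G] at
    [nu t]. *)
Lemma is_delta_derive_comp T T' nu G t l m : T t -> {homo nu : s / T s >-> T' s} ->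
  fjump T' (nu t) = nu (fjump T t) ->
  is_delta_derive T nu t l -> is_delta_derive T' G (nu t) m ->
  is_delta_derive T (G \o nu) t (m * l).
Proof.
move=> Tt homo_nu jump_nu dnu dG e e0 /=.
have K0 : 0 <= `|l| + 1 + `|m|.
  by have := normr_ge0 l; have := normr_ge0 m; lra.
have [d [d0 d1 de]] := small_factor _ _ K0 e0.
have /nbhs_ballP[r /= r0 rG] := dG _ d0.
have := delta_derive_near _ _ _ _ Tt dnu _ r0; have := dnu _ d0; apply: filterS2 => s ds ns Ts.
have {}ds := ds Ts; have {}ns := ns Ts.
have := rG _ ns (homo_nu _ Ts); rewrite jump_nu.
set u := fjump T t in ds *; set v := nu u; set w := nu s => h.
have -> : G v - G w - m * l * (u - s) =
  (G v - G w - m * (v - w)) + m * (v - w - l * (u - s)) by ring.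
apply: le_trans (ler_normD _ _) _; rewrite normrM.
have vw : `|v - w| <= (`|l| + 1) * `|u - s|.
  have -> : v - w = (v - w - l * (u - s)) + l * (u - s) by ring.
  apply: le_trans (ler_normD _ _) _; rewrite normrM.
  have := ler_wpM2r (normr_ge0 (u - s)) d1; lra.
have h1 := ler_wpM2l (ltW d0) vw.
have h2 := ler_wpM2l (normr_ge0 m) ds.
have h3 := ler_wpM2r (normr_ge0 (u - s)) de.
lra.
Qed.

(** The definition evaluates the function only at points of [T] and at the jump, which closedness
    puts in [T]. *)
Lemma delta_derive_eq_on T f g t l : closed T -> unbounded_above T ->
  {in T, f =1 g} -> is_delta_derive T f t l -> is_delta_derive T g t l.
Proof.
move=> cT Tub fg df e e0; have := df _ e0; apply: filterS => s fs Ts.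
by rewrite -!fg ?inE//; [exact: fs|exact: fjump_mem].
Qed.

(** * Sign and uniqueness of the derivative, and the delta integral *)

Section Closed.
Variable T : set R.
Hypotheses (cT : closed T) (Tub : unbounded_above T).

Lemma is_delta_derive_ge0 F t l : T t -> {in T &, {homo F : s u / s <= u}} ->
  is_delta_derive T F t l -> 0 <= l.
Proof.
move=> Tt monoF dF; have Tu := fjump_mem _ cT Tub t.
have := fjump_ge _ Tub t; rewrite le_eqVlt => /orP[/eqP eqj|ltj].
- apply/ler_addgt0Pl => e e0.
  have /nbhs_ballP[r /= r0 rF] := dF _ e0.
  have [s [Ts ts sr]] := fjump_eq_near _ Tub _ _ (esym eqj) r0.
  have /rF /(_ Ts) : ball t r s by rewrite /ball/= ler0_norm; lra.
  rewrite -eqj ler_norml => /andP[+ _].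
  rewrite (ler0_norm (_ : t - s <= 0)); last lra.
  have Fst : F t <= F s by apply: monoF; rewrite ?inE//; exact: ltW.
  move=> h; have : 0 <= (e + l) * (s - t) by lra.
  by rewrite pmulr_lge0//; lra.
- have h := delta_derive_jump _ _ _ _ Tt dF.
  have : F t <= F (fjump T t) by apply: monoF; rewrite ?inE//; exact: ltW.
  by rewrite -subr_ge0 h pmulr_lge0// subr_gt0.
Qed.

(** The zero function [F - F] is nondecreasing and has derivative [m - l], so [l <= m]; the roles
    are symmetric. *)
Lemma is_delta_derive_unique F t l m : T t ->
  is_delta_derive T F t l -> is_delta_derive T F t m -> l = m.
Proof.
move=> Tt.
suff le_lm l' m' : is_delta_derive T F t l' -> is_delta_derive T F t m' -> l' <= m'.
  by move=> dl dm; apply/eqP; rewrite eq_le !le_lm.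
move=> dl dm; have h := is_delta_derive_lin _ _ _ _ (-1) _ _ dm dl.
suff : 0 <= m' + -1 * l' by lra.
by apply: (is_delta_derive_ge0 _ _ _ Tt _ h) => s u _ _ _ /=; lra.
Qed.

Lemma delta_deriveE F t l : T t -> is_delta_derive T F t l ->
  delta_derive T F t = l.
Proof.
move=> Tt dl; apply: is_delta_derive_unique (dl) => //.
by apply: xgetPex; exists l.
Qed.

(* Real induction on [T]: the set of points up to which the slope stays above
   [- e] contains its supremum, which can only be the right end. *)
Lemma delta_derive_nondecreasing F f : delta_antiderivative T f F ->
  (forall t, T t -> 0 <= f t) -> {in T &, {homo F : s u / s <= u}}.
Proof.
move=> dF f0 c d /set_mem Tc /set_mem Td; rewrite le_eqVlt => /orP[/eqP->//|cd].
(* The slack [e] absorbs the error of the derivative at right-dense points. *)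
suff slope e : 0 < e -> F c - F d <= e * (d - c).
  rewrite -subr_le0; apply/ler_addgt0Pl => e e0; rewrite addr0.
  have dc0 : 0 < d - c by lra.
  by have := slope _ (divr_gt0 e0 dc0); rewrite divfK// gt_eqF.
move=> e0; pose E := [set t | ts_itv T c d t /\ F c - F t <= e * (t - c)].
have Ec : E c by split; [split=> //=; lra | rewrite !subrr mulr0].
have hE : has_sup E by split; [exists c | exists d => t [[_ /= /andP[]]]].
pose w := sup E; have Tw : T w by apply: closed_sup hE => // t [[]].
have cw : c <= w by apply: ub_le_sup Ec; exact: hE.2.
have wd : w <= d by apply: ge_sup; [exists c | move=> t [[_ /= /andP[]]]].
(* The supremum need not be attained a priori; continuity of [F] at [w] carries the inequality
   over. *)
have Ew : F c - F w <= e * (w - c).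
  apply/ler_addgt0Pl => k k0.
  have [r [r0 r1 rk]] := small_factor e k (ltW e0) k0.
  have /nbhs_ballP[q /= q0 qF] := delta_derive_near _ _ _ _ Tw (dF _ Tw) _ k0.
  have [s Es sq] := sup_adherent q0 hE; rewrite -/w in sq.
  have sw : s <= w by apply: ub_le_sup Es; exact: hE.2.
  case: Es => -[Ts _] Fs.
  have /qF /(_ Ts) : ball w q s by rewrite /ball/= ger0_norm; lra.
  rewrite ltr_norml => /andP[+ _].
  have := ler_wpM2l (ltW e0) sw; lra.
move: wd; rewrite le_eqVlt => /orP[/eqP <-//|wd].
(* If [w < d], some point of [E] lies beyond [w]: a nearby one when [w] is right-dense, the jump of
   [w] otherwise. *)
exfalso; have upE s : E s -> s <= w by move=> Es; apply: ub_le_sup Es; exact: hE.2.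
have := fjump_ge _ Tub w; rewrite le_eqVlt => /orP[/eqP eqj|ltj].
- have /nbhs_ballP[r /= r0 rF] := dF _ Tw _ e0.
  have dw0 : 0 < d - w by lra.
  have m0 : 0 < Num.min r (d - w) by rewrite lt_min r0.
  have [s [Ts ws]] := fjump_eq_near _ Tub _ _ (esym eqj) m0.
  rewrite -ltrBlDl lt_min => /andP[sr sd].
  have /rF /(_ Ts) : ball w r s by rewrite /ball/= ler0_norm; lra.
  rewrite -eqj ler_norml => /andP[_].
  rewrite (ler0_norm (_ : w - s <= 0)); last lra.
  have := mulr_ge0 (f0 _ Tw) (_ : 0 <= s - w) => /(_ ltac:(lra)) fs h.
  suff /upE : E s by lra.
  by split; [split=> //=; lra | lra].
- have h := delta_derive_jump _ _ _ _ Tw (dF _ Tw).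
  suff /upE : E (fjump T w) by lra.
  have jd := fjump_le _ Tub _ _ Td wd.
  split; first by split; [exact: fjump_mem | rewrite /=; lra].
  have := mulr_ge0 (f0 _ Tw) (_ : 0 <= fjump T w - w) => /(_ ltac:(lra)) fs.
  have := mulr_ge0 (ltW e0) (_ : 0 <= fjump T w - w) => /(_ ltac:(lra)) es.
  lra.
Qed.

(** The choice in [delta_integral] returns the increment of some antiderivative [G]. Both [F - G]
    and [G - F] have derivative zero, hence are nondecreasing, so the increments agree. *)
Lemma delta_integralE f F c d : T c -> T d -> delta_antiderivative T f F ->
  delta_integral T f c d = F d - F c.
Proof.
move=> Tc Td dF.
have [G dG ->] : exists2 G, delta_antiderivative T f G &
    delta_integral T f c d = G d - G c.
  rewrite /delta_integral.
  apply: (xgetPex 0 (P := [set v | exists2 F, _ & v = F d - F c])).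
  by exists (F d - F c), F.
have dif H K : delta_antiderivative T f H -> delta_antiderivative T f K ->
    {in T &, {homo (fun u => H u + -1 * K u) : s u / s <= u}}.
  move=> dH dK; apply: (@delta_derive_nondecreasing _ (fun t => f t + -1 * f t)).
    by move=> t Tt; apply: is_delta_derive_lin; [exact: dH|exact: dK].
  by move=> t _; lra.
have iTc : c \in T by rewrite inE.
have iTd : d \in T by rewrite inE.
have h1 := dif _ _ dF dG; have h2 := dif _ _ dG dF.
by case: (leP c d) => [cd|/ltW cd];
  have := h1 _ _ _ _ cd; have := h2 _ _ _ _ cd => /(_ ltac:(done) ltac:(done)) ?
  /(_ ltac:(done) ltac:(done)) ?; lra.
Qed.

(* Integrate [(k + g) ^+ 2 >= 0] and choose [k] minus the mean of [g]. *)
Lemma delta_integral_cauchy_schwarz g G H c d : T c -> T d -> c < d ->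
  delta_antiderivative T g G ->
  delta_antiderivative T (fun t => g t ^+ 2) H ->
  (G d - G c) ^+ 2 <= (d - c) * (H d - H c).
Proof.
move=> Tc Td cd dG dH; set I := G d - G c.
pose k := - (I / (d - c)).
have : delta_antiderivative T (fun t => g t ^+ 2 + k * (2 * g t + k * 1))
    (fun u => H u + k * (2 * G u + k * u)).
  move=> t Tt; apply: is_delta_derive_lin; first exact: dH.
  apply: is_delta_derive_lin; last exact: is_delta_derive_id.
  apply: (delta_derive_eq_on _ (fun u => 0 + 2 * G u)) => //.
    by move=> u _; rewrite add0r.
  rewrite -[2 * g t]add0r; apply: is_delta_derive_lin; last exact: dG.
  exact: is_delta_derive_cst.
move=> /delta_derive_nondecreasing mono.
have : H c + k * (2 * G c + k * c) <= H d + k * (2 * G d + k * d).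
  apply: mono; rewrite ?inE//; last exact: ltW.
  by move=> t _; have := sqr_ge0 (g t + k); lra.
have dc0 : 0 < d - c by lra.
have kE : k * (d - c) = - I by rewrite /k mulNr divfK// gt_eqF.
move=> h; have {}h : 0 <= (H d - H c) + k * I.
  have -> : k * I = k * (2 * I + k * (d - c)) by rewrite kE; ring.
  by rewrite /I; lra.
have := mulr_ge0 (ltW dc0) h; rewrite mulrDr mulrA [_ * k]mulrC kE; lra.
Qed.

End Closed.
End DeltaDerive.

(** * Existence of antiderivatives *)

Section Antiderivative.
Context {R : realType}.
Implicit Types (T A : set R) (f g F G : R -> R) (c t s e : R).

(** Local boundedness and continuity at right-dense points are the two consequences of rd-continuity
    from which an antiderivative is built. Both pass to products. *)
Definition locally_bounded_on A f : Prop :=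
  forall t, A t -> exists B : R, \forall s \near t, A s -> `|f s| <= B.

Definition right_dense_continuous T f : Prop :=
  forall t, right_dense T t ->
    forall e, 0 < e -> \forall s \near t, T s -> `|f t - f s| < e.

Lemma right_dense_continuousM T f g : right_dense_continuous T f ->
  right_dense_continuous T g -> right_dense_continuous T (fun t => f t * g t).
Proof.
move=> cf cg t rt e e0.
have K0 : 0 <= `|f t| + 1 + `|g t|.
  by have := normr_ge0 (f t); have := normr_ge0 (g t); lra.
have e20 : 0 < e / 2 by lra.
have [d [d0 d1 de]] := small_factor _ _ K0 e20.
have := cg _ rt _ d0; have := cf _ rt _ d0; apply: filterS2 => s fs gs Ts.
have {}fs := fs Ts; have {}gs := gs Ts.
have -> : f t * g t - f s * g s = (f t - f s) * g t + f s * (g t - g s) by ring.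
apply: le_lt_trans (ler_normD _ _) _; rewrite !normrM.
have fsB : `|f s| <= `|f t| + 1.
  have -> : f s = f t - (f t - f s) by ring.
  by apply: le_trans (ler_normB _ _) _; lra.
have h1 := ler_wpM2r (normr_ge0 (g t)) (ltW fs).
have h2 := ler_pM (normr_ge0 _) (normr_ge0 _) fsB (ltW gs).
lra.
Qed.

Lemma locally_bounded_onM A f g : locally_bounded_on A f ->
  locally_bounded_on A g -> locally_bounded_on A (fun t => f t * g t).
Proof.
move=> bf bg t At; have [B hB] := bf _ At; have [B' hB'] := bg _ At.
exists (B * B'); move: hB hB'; apply: filterS2 => s hB hB' As.
by rewrite normrM ler_pM ?hB ?hB'.
Qed.

(** Compactness in near-covering form, with the bound [B] tending to infinity as the parameter,
    turns the local bounds into one. *)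
Lemma locally_bounded_on_itv T f c d : closed T -> locally_bounded_on T f ->
  exists B, forall s, T s -> c <= s <= d -> `|f s| <= B.
Proof.
move=> cT bf.
have : compact (ts_itv T c d).
  rewrite /ts_itv setIC; apply: compact_closedI => //.
  have -> : [set t | c <= t <= d] = [set` `[c, d]].
    by apply/seteqP; split=> s; rewrite /= in_itv /=.
  exact: segment_compact.
move=> /compact_near_coveringP ncov.
have /ncov : forall s, ts_itv T c d s ->
    \forall s' \near s & B \near pinfty_nbhs R, T s' -> `|f s'| <= B.
  move=> s [Ts _]; have [B hB] := bf _ Ts.
  exists ([set s' | T s' -> `|f s'| <= B], [set B' | B <= B']).
    by split=> //=; exact: nbhs_pinfty_ge (num_real B).
  by move=> [s' B'] /= [h1 h2] /h1 h3; exact: le_trans h2.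
move=> /filter_ex[B hB]; exists B => s Ts sI; apply: hB => //.
Qed.

Section Construction.
Variables (T : set R) (c : R) (f : R -> R).
Hypotheses (cT : closed T) (Tub : unbounded_above T).
Hypotheses (Tc : T c) (cmin : forall t, T t -> c <= t).
Hypothesis bf : locally_bounded_on T f.

(* Functions vanishing at [c] that grow on [[c, t]] at most as fast as an
   antiderivative of [f] can. *)
Definition subantiderivative t g : Prop := g c = 0 /\
  forall p q K, T p -> T q -> p <= q -> q <= t ->
    (forall s, T s -> p <= s -> s < q -> f s <= K) -> g q - g p <= K * (q - p).

(** This is the upper Darboux integral of [f] from [c] to [t], written without partitions. *)
Definition sup_subantiderivative t : R :=
  sup [set y | exists2 g, subantiderivative t g & y = g t].

Local Notation F := sup_subantiderivative.

Lemma subantiderivativeW t t' g : t <= t' ->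
  subantiderivative t' g -> subantiderivative t g.
Proof.
move=> tt' [g0 sg]; split=> // p q K Tp Tq pq qt.
by apply: sg => //; exact: le_trans tt'.
Qed.

Lemma has_sup_subantiderivative t : T t ->
  has_sup [set y | exists2 g, subantiderivative t g & y = g t].
Proof.
move=> Tt; have [B hB] := locally_bounded_on_itv T f c t cT bf.
split.
(* Slope [- B] lies below every admissible [K], since [- B <= f p <= K] once [p < q]. For [p = q]
   nothing constrains [K], but both sides vanish. *)
- exists (- B * (t - c)), (fun s => - B * (s - c)) => //.
  split=> [|p q K Tp Tq]; first by rewrite subrr mulr0.
  rewrite le_eqVlt => /orP[/eqP->|pq qt fK]; first by rewrite !subrr mulr0.
  have -> : - B * (q - c) - - B * (p - c) = - B * (q - p) by ring.
  rewrite ler_wpM2r//; first lra.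
  apply: (le_trans _ (fK _ Tp (lexx _) pq)).
  have : `|f p| <= B by apply: hB => //; rewrite cmin//=; lra.
  by rewrite ler_norml => /andP[].
- exists (B * (t - c)) => y [g [g0 sg] ->].
  rewrite -[g t]subr0 -g0; apply: sg => //; first exact: cmin.
  move=> s Ts cs st; apply: le_trans (ler_norm _) _.
  by apply: hB => //; rewrite cs ltW.
Qed.

Lemma le_sup_subantiderivative t g : T t -> subantiderivative t g -> g t <= F t.
Proof.
move=> Tt sg; apply: ub_le_sup; last by exists g.
by have [] := has_sup_subantiderivative t Tt.
Qed.

Lemma sup_subantiderivative_le u v K : T u -> T v -> u <= v ->
  (forall s, T s -> u <= s -> s < v -> f s <= K) -> F v - F u <= K * (v - u).
Proof.
move=> Tu Tv uv fK; rewrite lerBlDr.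
apply: ge_sup; first by have [] := has_sup_subantiderivative v Tv.
move=> _ [g sg ->].
have := sg.2 u v K Tu Tv uv (lexx _) fK.
have := le_sup_subantiderivative _ _ Tu (subantiderivativeW _ _ _ uv sg).
lra.
Qed.

(** A competitor up to [u] is prolonged beyond [u] by a line of slope [m]; it stays a competitor
    because [m <= f] there. *)
Lemma sup_subantiderivative_ge u v m : T u -> T v -> u <= v ->
  (forall s, T s -> u <= s -> s < v -> m <= f s) -> m * (v - u) <= F v - F u.
Proof.
move=> Tu Tv uv fm.
suff : F u <= F v - m * (v - u) by lra.
apply: ge_sup; first by have [] := has_sup_subantiderivative u Tu.
move=> _ [g sg ->].
pose g' s := if s <= u then g s else g u + m * (s - u).
have g'v : g' v = g u + m * (v - u).
  rewrite /g'; case: ifP => // vu; have -> : v = u by lra.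
  by rewrite subrr mulr0 addr0.
suff /le_sup_subantiderivative : subantiderivative v g'.
  by move=> /(_ Tv); rewrite g'v; lra.
split=> [|p q K Tp Tq pq qv fK]; first by rewrite /g' cmin//; exact: sg.1.
have mK r : T r -> u <= r -> p <= r -> r < q -> m * (q - r) <= K * (q - r).
  move=> Tr ur pr rq; rewrite ler_wpM2r//; first lra.
  by apply: (@le_trans _ _ (f r)); [apply: fm => //; lra|apply: fK].
rewrite /g'; case: (leP q u) => qu.
  by rewrite (le_trans pq qu); exact: sg.2.
case: (leP p u) => pu.
  have := sg.2 p u K Tp Tu pu (lexx _) (fun s Ts ps su => fK s Ts ps (lt_trans su qu)).
  by have := mK u Tu (lexx _) pu qu; lra.
move: pq; rewrite le_eqVlt => /orP[/eqP->|pq]; first by rewrite !subrr mulr0.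
by have := mK p Tp (ltW pu) (lexx _) pq; lra.
Qed.

Lemma sup_subantiderivative_near k e u v : T u -> T v -> u <= v ->
  (forall s, T s -> u <= s -> s < v -> `|k - f s| <= e) ->
  `|F v - F u - k * (v - u)| <= e * (v - u).
Proof.
move=> Tu Tv uv fk; rewrite ler_norml.
have h1 := sup_subantiderivative_le u v (k + e) Tu Tv uv.
have h2 := sup_subantiderivative_ge u v (k - e) Tu Tv uv.
have {}h1 : F v - F u <= (k + e) * (v - u).
  by apply: h1 => s Ts us sv; have := fk _ Ts us sv; rewrite ler_norml; lra.
have {}h2 : (k - e) * (v - u) <= F v - F u.
  by apply: h2 => s Ts us sv; have := fk _ Ts us sv; rewrite ler_norml; lra.
by apply/andP; split; lra.
Qed.

(** At a right-dense [t], [f] is within [e] of [f t] nearby, and so are the slopes of [F]. At a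
    right-scattered [t], the only point of [T] in [[t, u[] is [t], so the increment over the gap is
    exact. *)
Lemma delta_antiderivative_sup : right_dense_continuous T f ->
  delta_antiderivative T f F.
Proof.
move=> cf t Tt e e0.
have := fjump_ge _ Tub t; rewrite le_eqVlt => /orP[/eqP eqj|ltj].
- have rt : right_dense T t by split.
  have /nbhs_ballP[r /= r0 rf] := cf _ rt _ e0.
  rewrite -eqj; exists r => //= s; rewrite /ball/= => ts Ts.
  have fk p : T p -> `|t - p| < r -> `|f t - f p| <= e.
    by move=> Tp pr; apply: ltW; exact: rf.
  have [st|/ltW st] := leP s t.
    rewrite [X in _ <= _ * X]ger0_norm; last lra.
    apply: sup_subantiderivative_near => // p Tp sp pt; apply: fk => //.
    by move: ts; rewrite !ger0_norm; lra.
  rewrite [X in _ <= _ * X]ler0_norm; last lra.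
  have -> : F t - F s - f t * (t - s) = - (F s - F t - f t * (s - t)) by ring.
  rewrite normrN opprB.
  apply: sup_subantiderivative_near => // p Tp tp ps; apply: fk => //.
  by move: ts; rewrite !ler0_norm; lra.
- set u := fjump T t in ltj *; have Tu : T u by exact: fjump_mem.
  have Ftu : F u - F t = f t * (u - t).
    apply/eqP; rewrite -subr_eq0 -normr_le0 -(mul0r (u - t)).
    apply: sup_subantiderivative_near => //; first exact: ltW.
    move=> s Ts ts su; have st := lt_fjump _ Tub _ _ Ts su.
    by have -> : s = t by [lra]; rewrite subrr normr0.
  (* To the left of [t] only boundedness is available; the error [2 B (t - s)] is absorbed by
     [e (u - t)], positive as [t] is right-scattered. *)
  have [B hB] := locally_bounded_on_itv T f c t cT bf.
  have ut0 : 0 < e * (u - t) by rewrite mulr_gt0// subr_gt0.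
  have [d [d0 _ de]] := small_factor _ _ (normr_ge0 (B + B)) ut0.
  have := lt_nbhsl ltj; have := near_dist t _ d0.
  apply: filterS2 => s ts su Ts.
  have st := lt_fjump _ Tub _ _ Ts su.
  have -> : F u - F s - f t * (u - s) = F t - F s - f t * (t - s) by lra.
  rewrite [X in _ <= _ * X]ger0_norm; last lra.
  have : `|F t - F s - f t * (t - s)| <= (B + B) * (t - s).
    apply: sup_subantiderivative_near => // p Tp sp pt.
    apply: le_trans (ler_normB _ _) _.
    by rewrite lerD// hB// cmin ?lexx//= ltW.
  have ts0 : 0 <= t - s by lra.
  move=> /le_trans; apply; move: ts; rewrite ger0_norm// => /ltW ts.
  have h1 := ler_wpM2r ts0 (ler_norm (B + B)).
  have h2 := ler_wpM2r (normr_ge0 (B + B)) ts.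
  have h3 : e * (u - t) <= e * (u - s) by rewrite (ler_wpM2l (ltW e0))//; lra.
  lra.
Qed.

End Construction.
End Antiderivative.

(** * Local boundedness of rd-continuous functions *)

Section RdContinuous.
Context {R : realType}.
Implicit Types (T A : set R) (f : R -> R) (t e : R).

Lemma rd_continuous_right_dense T A f t e : rd_continuous T A f -> A t ->
  right_dense T t -> 0 < e -> \forall s \near t, A s -> `|f t - f s| < e.
Proof.
move=> rf At rt e0; have /cvgr_dist_lt/(_ _ e0) := (rf _ At).1 rt.
by rewrite near_withinE.
Qed.

Lemma near_bounded A f t l : (forall e, 0 < e -> \forall s \near t, A s -> `|l - f s| < e) ->
  \forall s \near t, A s -> `|f s| <= `|l| + 1.
Proof.
move=> /(_ 1 ltr01); apply: filterS => s fs As; have {}fs := fs As.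
have -> : f s = l - (l - f s) by ring.
by apply: le_trans (ler_normB _ _) _; lra.
Qed.

Lemma rd_continuous_locally_bounded T A f : closed T -> unbounded_above T ->
  A `<=` T -> rd_continuous T A f -> locally_bounded_on A f.
Proof.
move=> cT Tub AT rf t At; have Tt := AT _ At.
have := fjump_ge _ Tub t; rewrite le_eqVlt => /orP[/eqP eqj|ltj].
  have rt : right_dense T t by split.
  by exists (`|f t| + 1); apply: near_bounded => e; exact: rd_continuous_right_dense rf At rt.
(* At a right-scattered [t] no nearby point lies to the right. On the left either [t] is left-dense
   and [f] has a limit, or there are no nearby points. *)
suff [B hB] : exists B : R, \forall s \near t, A s -> s < t -> `|f s| <= B.
  exists (Num.max B `|f t|); move: (lt_nbhsl ltj) hB; apply: filterS2 => s su hB As.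
  have := lt_fjump _ Tub _ _ (AT _ As) su; rewrite le_eqVlt => /orP[/eqP->|st].
    by rewrite le_max lexx orbT.
  by rewrite le_max hB.
have [|nl] := pselect (left_dense T t).
  move=> /(rf _ At).2[l fl]; exists (`|l| + 1).
  suff : \forall s \near t, (A `&` [set s | s < t]) s -> `|f s| <= `|l| + 1.
    by apply: filterS => s hs As st; apply: hs.
  apply: near_bounded => e e0; have /cvgr_dist_lt/(_ _ e0) := fl.
  by rewrite near_withinE.
pose E := [set s | T s /\ s < t].
have ubE : has_ubound E by exists t => s [_ /ltW].
have [E0|E0] := pselect (E !=set0); last first.
  by exists 0; near=> s => As st; exfalso; apply: E0; exists s; split=> //; exact: AT.
have : bjump T t < t.
  rewrite lt_neqAle (_ : bjump T t <= t) ?andbT; last first.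
    by apply: ge_sup => // s [_ /ltW].
  by apply/eqP => h; apply: nl.
move=> /lt_nbhsr bt; exists 0; move: bt; apply: filterS => s bs As st.
suff : s <= bjump T t by rewrite leNgt bs.
by apply: ub_le_sup => //; split=> //; exact: AT.
Unshelve. all: by end_near.
Qed.

End RdContinuous.

(** * Increasing bijections between time scales *)

Section IncreasingBijection.
Context {R : realType}.
Variables (T T' : set R) (nu : R -> R).
Hypotheses (cT : closed T) (Tub : unbounded_above T).
Hypotheses (cT' : closed T') (Tub' : unbounded_above T').
Hypothesis nu_incr : forall t u, T t -> T u -> t < u -> nu t < nu u.
Hypothesis nu_onto : nu @` T = T'.

Lemma incr_le t u : T t -> T u -> nu t <= nu u -> t <= u.
Proof.
by move=> Tt Tu; apply: contraTT; rewrite -!ltNge; exact: nu_incr.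
Qed.

Lemma incr_lt t u : T t -> T u -> nu t < nu u -> t < u.
Proof.
move=> Tt Tu; apply: contraTT; rewrite -!leNgt => ut.
move: ut; rewrite le_eqVlt => /predU1P[->//|ut].
by apply: ltW; exact: nu_incr.
Qed.

(** An order isomorphism preserves the absence or presence of points just after [t]. The jump of
    [nu t] is pulled back to [q], which is compared with the jump of [t] both ways. *)
Lemma fjump_incr t : T t -> fjump T' (nu t) = nu (fjump T t).
Proof.
move=> Tt; have T'nu s : T s -> T' (nu s) by move=> Ts; rewrite -nu_onto; exists s.
have Tu := fjump_mem _ cT Tub t; have := fjump_mem _ cT' Tub' (nu t).
rewrite -{1}nu_onto => -[q Tq qE]; rewrite -qE; congr nu.
have tq : t <= q by apply: incr_le => //; rewrite qE fjump_ge.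
apply/eqP; rewrite eq_le; apply/andP; split.
- have := fjump_ge _ Tub t; rewrite [t <= _]le_eqVlt => /orP[/eqP eqj|ltj].
    rewrite -eqj leNgt; apply/negP => tq'.
    have qt0 : 0 < q - t by rewrite subr_gt0.
    have [s [Ts ts sq]] := fjump_eq_near _ Tub _ _ (esym eqj) qt0.
    have : s <= t; last by lra.
    apply: incr_le => //; apply: (lt_fjump _ Tub'); first exact: T'nu.
    by rewrite -qE; apply: nu_incr => //; lra.
  apply: incr_le => //; rewrite qE; apply: fjump_le => //; first exact: T'nu.
  exact: nu_incr.
- move: tq; rewrite [t <= _]le_eqVlt => /orP[/eqP eqt|tq]; last exact: fjump_le.
  rewrite leNgt; apply/negP => qu.
  have jE : fjump T' (nu t) = nu t by rewrite -qE -eqt.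
  have u0 : 0 < nu (fjump T t) - nu t.
    by rewrite subr_gt0; apply: nu_incr => //; rewrite {1}eqt.
  have [s' []] := fjump_eq_near _ Tub' _ _ jE u0.
  rewrite -nu_onto => -[s Ts <-] ts su.
  have h1 : t < s by exact: incr_lt.
  have h2 : s < fjump T t by apply: incr_lt => //; lra.
  by have := lt_fjump _ Tub _ _ Ts h2; lra.
Qed.

Lemma right_dense_incr t : T t -> right_dense T' (nu t) -> right_dense T t.
Proof.
move=> Tt [_]; rewrite fjump_incr// => h; split=> //.
have Tu := fjump_mem _ cT Tub t.
by apply/eqP; rewrite eq_le; apply/andP; split; apply: incr_le => //; rewrite h.
Qed.

(** Continuity of the inverse of [nu], from order alone: the last point of [T] up to [t - e] and the
    first from [t + e] on have images strictly on either side of [nu t]. *)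
Lemma near_incr t e : T t -> 0 < e ->
  \forall r \near nu t, forall s, T s -> nu s = r -> `|t - s| < e.
Proof.
move=> Tt e0.
have lower : \forall r \near nu t, forall s, T s -> nu s = r -> t - e < s.
  pose E := [set s | T s /\ s <= t - e].
  have [E0|E0] := pselect (E !=set0); last first.
    near=> r => s Ts _; rewrite ltNge; apply/negP => h.
    by apply: E0; exists s.
  have ubE : has_ubound E by exists (t - e) => s [].
  have Tw : T (sup E) by apply: closed_sup => // s [].
  have wt : sup E < t.
    by have : sup E <= t - e; [apply: ge_sup => // s [] | lra].
  have := lt_nbhsr (nu_incr _ _ Tw Tt wt); apply: filterS => r wr s Ts sr.
  rewrite ltNge; apply/negP => h; have : sup E < s by apply: incr_lt => //; rewrite sr.
  by rewrite ltNge ub_le_sup.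
have upper : \forall r \near nu t, forall s, T s -> nu s = r -> s < t + e.
  pose E := [set s | T s /\ t + e <= s].
  have E0 : E !=set0.
    by have [s Ts /ltW] := unbounded_gt T (t + e) Tub; exists s.
  have lbE : has_lbound E by exists (t + e) => s [].
  have Tw : T (inf E) by apply: closed_inf => // s [].
  have wt : t < inf E.
    by have : t + e <= inf E; [apply: lb_le_inf => // s [] | lra].
  have := lt_nbhsl (nu_incr _ _ Tt Tw wt); apply: filterS => r wr s Ts sr.
  rewrite ltNge; apply/negP => h; have : s < inf E by apply: incr_lt => //; rewrite sr.
  by rewrite ltNge ge_inf.
move: lower upper; apply: filterS2 => r h1 h2 s Ts sr.
by have := h1 _ Ts sr; have := h2 _ Ts sr; rewrite ltr_norml; lra.
Unshelve. all: by end_near.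
Qed.

End IncreasingBijection.

(* [p], [X], [r] are the values of [b_+], [x] and [b^2 x(delta_-)^2 delta_-^Delta]
   at the current point; [X + I] is [A]. *)
Lemma lyapunov_inequality (R : realType) (q p D X I W mu r : R) :
  0 <= q -> 0 <= mu -> 0 <= r -> 0 <= D -> D * p ^+ 2 <= q -> I ^+ 2 <= D * W ->
  q * ((X + I) ^+ 2 - D * W) <=
  q * X * (X + I + (X + I + q * X * mu)) - D * (p ^+ 2 * X ^+ 2 - r).
Proof.
move=> q0 mu0 r0 D0 pq IW.
have h1 := ler_wpM2l q0 IW; have h2 := ler_wpM2r (sqr_ge0 X) pq.
have h3 := mulr_ge0 (sqr_ge0 (q * X)) mu0; have h4 := mulr_ge0 D0 r0.
lra.
Qed.

(** * The Lyapunov function along a solution *)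

Theorem theorem7 (R : realType) (T Tstar : set R) (t0 h : R)
    (dm dp : R -> R -> option R) (a b : R -> R) (M D : R)
    (hT : time_scale T) (hTub : unbounded_above T)
    (hshift : shift_operators T Tstar t0 dm dp)
    (hdelay : delay_shift T Tstar t0 dm dp h)
    (ht0 : 0 <= t0)
    (ha : rd_continuous T T a) (hb : rd_continuous T T b)
    (hM : forall t, ts_ray T t0 t ->
       `|delta_derive (ts_ray T t0) (shift_val dm h) t| <= M) :
  let nu := shift_val dm h in
  let bp := fun t => b (shift_val dp h t) in
  let Q := fun t => a t + bp t in
  let beta := fun t => t - nu t in
  0 < D ->
  (forall t, ts_ray T t0 t ->
     [/\ bp t != 0, beta t < D & D <= Q t / bp t ^+ 2]) ->
  forall psi x : R -> R,
  rd_continuous T (ts_itv T (nu t0) t0) psi ->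
  is_solution T t0 dm h a b psi x ->
  let S := ts_ray T (nu t0) in
  let A := fun t => x t + delta_integral S (fun s => bp s * x s) (nu t) t in
  let V := fun t => A t ^+ 2
    - D * delta_integral S (fun s => bp s ^+ 2 * x s ^+ 2) (nu t) t in
  forall t, ts_ray T t0 t ->
    delta_derivable (ts_ray T t0) V t /\
    Q t * V t <= delta_derive (ts_ray T t0) V t.
Proof.
move=> nu bp Q beta D0 hD psi x rpsi [xE xpsi] S A V t rt.
(* Derivatives are taken on [P], integrals on the larger ray [S], which also contains the initial
   interval. *)
have [_ cT] := hT; set P := ts_ray T t0 in rt *.
have cP : closed P by exact: closed_ray.
have Pub : unbounded_above P by exact: unbounded_ray.
have cS : closed S by exact: closed_ray.
have Sub : unbounded_above S by exact: unbounded_ray.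
have nuP : nu @` P = S := delay_onto hdelay.
have nu_incr : forall s u, P s -> P u -> s < u -> nu s < nu u.
  exact: delay_increasing hdelay.
have Snu s : P s -> S (nu s) by move=> Ps; rewrite -nuP; exists s.
have Pt0 : P t0.
  by split; [exact: shift_sub hshift _ (shift_init hshift) | exact: lexx].
(* P.3 and P.4 give [dm t0 s = s]; as [t0 < h], P.2 makes [dm h s] smaller. *)
have lt_nu s : P s -> nu s < s.
  move=> Ps; have domh := delay_domm hdelay Ps.
  have [_ ss _] := domh.
  have [dom0 e0] := shift_P3_star hshift ss.
  have [] := shift_P4p hshift dom0; rewrite e0 => dom0' e0'.
  rewrite -[X in _ < X]e0'; apply: (shift_P2m hshift) => //.
  by have [_ +] := delay_h hdelay.
have PS : P `<=` S.
  move=> s [Ts ts]; split=> //; apply: ltW.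
  by apply: lt_le_trans ts; exact: lt_nu.
have jumpP s : P s -> fjump P s = fjump T s by move=> [_ ?]; exact: fjump_ray.
have jumpS s : S s -> fjump S s = fjump T s by move=> [_ ?]; exact: fjump_ray.
have jumpPS s : P s -> fjump P s = fjump S s.
  by move=> Ps; rewrite jumpP// jumpS//; exact: PS.
have dnu s : P s -> is_delta_derive P nu s (delta_derive P nu s).
  by move=> Ps; have [l dl] := delay_derivable hdelay Ps; apply: xgetPex; exists l.
have dx s : P s -> is_delta_derive P x s (delta_derive P x s).
  by move=> Ps; have [[l dl] _] := xE _ Ps; apply: xgetPex; exists l.
have bpnu s : P s -> bp (nu s) = b s.
  by move=> Ps; rewrite /bp (delay_invl hdelay).
have bT := rd_continuous_locally_bounded _ _ _ cT hTub (@subset_refl _ T) hb.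
(* On [S], [bp] is [b] composed with the inverse of [nu], so both properties of [b] are transported
   by [near_incr]. *)
have cbp : right_dense_continuous S bp.
  move=> u ru e e0; have [Su _] := ru; move: (Su); rewrite -{1}nuP => -[s Ps su].
  have rs : right_dense T s.
    split; first exact: Ps.1.
    rewrite -jumpP//; have : right_dense S (nu s) by rewrite su.
    by move/(right_dense_incr _ _ _ cP Pub cS Sub nu_incr nuP _ Ps) => [].
  have /nbhs_ballP[r /= r0 rb] := rd_continuous_right_dense _ _ _ _ _ hb Ps.1 rs e0.
  rewrite -su; have := near_incr _ _ cP Pub nu_incr _ _ Ps r0.
  apply: filterS => w near_w; rewrite -nuP => -[s' Ps' s'w].
  by rewrite -s'w !bpnu//; apply: rb; [exact: near_w|exact: Ps'.1].
have bbp : locally_bounded_on S bp.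
  move=> u; rewrite -{1}nuP => -[s Ps <-].
  have [B /nbhs_ballP[r /= r0 rb]] := bT _ Ps.1; exists B.
  have := near_incr _ _ cP Pub nu_incr _ _ Ps r0.
  apply: filterS => w near_w; rewrite -nuP => -[s' Ps' s'w].
  by rewrite -s'w bpnu//; apply: rb; [exact: near_w|exact: Ps'.1].
pose J := ts_itv T (nu t0) t0.
(* On [P], [x] is differentiable, and on [J] it equals [psi]. Away from [t0] only one piece is near;
   at [t0] the two estimates are combined. *)
have S_cover s : S s -> P s \/ J s.
  move=> [Ts cs]; have [?|/ltW ?] := leP t0 s; first by left.
  by right; split=> //=; rewrite cs.
have nearP s : s < t0 -> \forall u \near s, ~ P u.
  by move=> /lt_nbhsl; apply: filterS => u ut [_ /=]; lra.
have nearJ s : t0 < s -> \forall u \near s, ~ J u.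
  by move=> /lt_nbhsr; apply: filterS => u ut [_ /= /andP[]]; lra.
have JT : J `<=` T by move=> s [].
have bpsi := rd_continuous_locally_bounded _ _ _ cT hTub JT rpsi.
have cx : right_dense_continuous S x.
  move=> u [Su ru] e e0.
  have h1 : \forall s \near u, P s -> `|x u - x s| < e.
    have [ut|tu] := ltP u t0; first by have := nearP _ ut; apply: filterS.
    have Pu : P u by split=> //; exact: Su.1.
    exact: delta_derive_near (dx _ Pu) _ e0.
  have h2 : \forall s \near u, J s -> `|x u - x s| < e.
    have [ut|tu] := ltP t0 u; first by have := nearJ _ ut; apply: filterS.
    have Ju : J u by split; [exact: Su.1|rewrite /= tu andbT; exact: Su.2].
    have ru' : right_dense T u by split; [exact: Su.1|rewrite -jumpS].
    have := rd_continuous_right_dense _ _ _ _ _ rpsi Ju ru' e0.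
    by apply: filterS => s hs Js; rewrite !xpsi//; exact: hs.
  by move: h1 h2; apply: filterS2 => s h1 h2 /S_cover[].
have bx : locally_bounded_on S x.
  move=> u Su.
  have [B1 h1] : exists B : R, \forall s \near u, P s -> `|x s| <= B.
    have [ut|tu] := ltP u t0; first by exists 0; have := nearP _ ut; apply: filterS.
    have Pu : P u by split=> //; exact: Su.1.
    by exists (`|x u| + 1); apply: near_bounded; exact: delta_derive_near (dx _ Pu).
  have [B2 h2] : exists B : R, \forall s \near u, J s -> `|x s| <= B.
    have [ut|tu] := ltP t0 u; first by exists 0; have := nearJ _ ut; apply: filterS.
    have Ju : J u by split; [exact: Su.1|rewrite /= tu andbT; exact: Su.2].
    have [B hB] := bpsi _ Ju; exists B; move: hB.
    by apply: filterS => s hs Js; rewrite xpsi//; exact: hs.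
  exists (Num.max B1 B2); move: h1 h2; apply: filterS2 => s h1 h2 /S_cover[?|?].
    by rewrite le_max h1.
  by rewrite le_max h2// orbT.
have anti f : right_dense_continuous S f -> locally_bounded_on S f ->
    exists F, delta_antiderivative S f F.
  move=> cf bf; exists (sup_subantiderivative S (nu t0) f).
  by apply: delta_antiderivative_sup => //; [exact: Snu | move=> s []].
pose g s := bp s * x s.
have cg : right_dense_continuous S g by exact: right_dense_continuousM.
have bg : locally_bounded_on S g by exact: locally_bounded_onM.
have [G dG] := anti _ cg bg.
have [H] := anti _ (right_dense_continuousM _ _ _ cg cg) (locally_bounded_onM _ _ _ bg bg).
rewrite (_ : (fun s => g s * g s) = (fun s => bp s ^+ 2 * x s ^+ 2)); last first.
  by apply/funext => s; rewrite /g; ring.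
move=> dH.
have restrict F s l : P s -> is_delta_derive S F s l -> is_delta_derive P F s l.
  by move=> Ps; apply: is_delta_derive_subset => //; exact: jumpPS.
(* Derivative of an integral over the delay interval: restriction to [P] at the upper limit, the
   chain rule at the lower one. *)
have dint F f s : delta_antiderivative S f F -> P s ->
    is_delta_derive P (fun u => F u + -1 * F (nu u)) s
      (f s + -1 * (f (nu s) * delta_derive P nu s)).
  move=> dF Ps; apply: is_delta_derive_lin; first by apply: restrict => //; exact/dF/PS.
  apply: (is_delta_derive_comp _ S) => //; first by exact: fjump_incr.
  - exact: dnu.
  - exact/dF/Snu.
have AE s : P s -> A s = x s + 1 * (G s + -1 * G (nu s)).
  move=> Ps; rewrite /A (delta_integralE _ cS Sub _ _ _ _ (Snu _ Ps) (PS _ Ps) dG).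
  by lra.
have VE s : P s -> V s = A s ^+ 2 + - D * (H s + -1 * H (nu s)).
  move=> Ps; rewrite /V (delta_integralE _ cS Sub _ _ _ _ (Snu _ Ps) (PS _ Ps) dH).
  by lra.
have dA s : P s -> is_delta_derive P A s (Q s * x s).
  move=> Ps; have := is_delta_derive_lin _ _ _ _ 1 _ _ (dx _ Ps) (dint _ _ _ dG Ps).
  move=> /(delta_derive_eq_on _ _ A _ _ cP Pub) Axs.
  have -> : Q s * x s = delta_derive P x s +
      1 * (g s + -1 * (g (nu s) * delta_derive P nu s)).
    by rewrite (xE _ Ps).2 /g bpnu// /Q /g -/P -/nu; ring.
  by apply: Axs => u /set_mem Pu; rewrite AE.
have dV := is_delta_derive_lin _ _ _ _ (- D) _ _
  (is_delta_derive_sqr _ _ _ _ rt (dA _ rt)) (dint _ _ _ dH rt).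
move: dV => /(delta_derive_eq_on _ _ V _ _ cP Pub) dV.
have {}dV := dV (fun s Ps => esym (VE s (set_mem Ps))).
split; first by eexists; exact: dV.
rewrite (delta_deriveE _ cP Pub _ _ _ rt dV).
have Aj := delta_derive_jump _ _ _ _ rt (dA _ rt).
(* Turns the sum of [A] at [t] and at its jump, from the derivative of the square, into
   [2 A + mu Q x]. *)
have -> : A (fjump P t) = A t + Q t * x t * (fjump P t - t) by lra.
have [bp0 betaD DQ] := hD _ rt.
have pq : D * bp t ^+ 2 <= Q t by rewrite -ler_pdivlMr// exprn_even_gt0.
have ntS := lt_nu _ rt.
have dg2 : delta_antiderivative S (fun s => g s ^+ 2) H.
  move=> s Ss; have -> : g s ^+ 2 = bp s ^+ 2 * x s ^+ 2 by rewrite /g exprMn.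
  exact: dH.
have CS := delta_integral_cauchy_schwarz _ cS Sub _ _ _ _ _
  (Snu _ rt) (PS _ rt) ntS dG dg2.
have W0 : 0 <= H t - H (nu t).
  rewrite subr_ge0; apply: (delta_derive_nondecreasing _ cS Sub _ _ dg2).
  - by move=> s _; exact: sqr_ge0.
  - by rewrite inE; exact: Snu.
  - by rewrite inE; exact: PS.
  - exact: ltW.
have IW : (G t - G (nu t)) ^+ 2 <= D * (H t - H (nu t)).
  by apply: le_trans CS _; rewrite ler_wpM2r//; exact: ltW.
have nu'0 : 0 <= delta_derive P nu t.
  apply: (is_delta_derive_ge0 _ cP Pub _ _ _ rt _ (dnu _ rt)).
  move=> s u /set_mem Ps /set_mem Pu; rewrite le_eqVlt => /orP[/eqP->//|su].
  by apply: ltW; exact: nu_incr.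
have r0 : 0 <= bp (nu t) ^+ 2 * x (nu t) ^+ 2 * delta_derive P nu t.
  by apply: mulr_ge0 => //; apply: mulr_ge0; exact: sqr_ge0.
have Q0 : 0 <= Q t by apply: le_trans pq; rewrite mulr_ge0 ?sqr_ge0// ltW.
have mu0 : 0 <= fjump P t - t by rewrite subr_ge0 fjump_ge.
have := lyapunov_inequality _ _ _ _ (x t) _ _ _ _ Q0 mu0 r0 (ltW D0) pq IW.
rewrite VE// AE//; lra.
Qed.
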